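(* Let $\lambda=(\lambda_1,\lambda_2,\ldots,\lambda_k)$ be the Ferrers diagram of a partition (possibly empty), placed in the northwest corner of the grid, and for integers $m,n\ge 0$ let $N(m,n)$ be the number of northeastern lattice paths in the grid from $(m,0)$ to $(0,n)$ that do not go inside $\lambda$. Then for all integers $m,n\ge 0$ the sequence $$ N(0,m+n),\ N(1,m+n-1),\ \ldots,\ N(m+n,0) $$ is log concave; that is, with $L=m+n$ and $a_i=N(i,L-i)$ for $0\le i\le L$, one has $a_{i-1}\,a_{i+1}\le a_i^2$ for all $1\le i\le L-1$.
   Context: Grid: the vertices are labeled $(i,j)$ with integers $i,j\ge 0$ in matrix-style coordinates. The first coordinate $i$ is the row index, increasing to the south; the second coordinate $j$ is the column index, increasing to the east. The northwest corner is $(0,0)$. Ferrers diagram: a partition is a weakly decreasing sequence of positive integers $\lambda_1\ge\lambda_2\ge\cdots\ge\lambda_k>0$, with the convention $\lambda_r=0$ for $r>k$. The empty partition $\lambda=\emptyset$ is allowed. Its Ferrers diagram is drawn in English notation in the northwest corner of the grid, so that its squares coincide with grid squares: the square with northwest vertex $(i,j)$ and southeast vertex $(i+1,j+1)$ belongs to $\lambda$ if and only if $j<\lambda_{i+1}$. Northeastern lattice path: a lattice path in the grid in which each step goes one unit north, $(i,j)\to(i-1,j)$, or one unit east, $(i,j)\to(i,j+1)$. Not going inside $\lambda$: the diagram $\lambda$ is regarded as removed from the northwest corner of the grid. A path does not go inside $\lambda$ if it stays weakly southeast of $\lambda$, i.e. every vertex $(i,j)$ of the path satisfies $j\ge\lambda_{i+1}$.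 The path may touch the southeastern boundary of $\lambda$. In particular, $N(m,n)=0$ if the starting point $(m,0)$ satisfies $m<k$ or the ending point $(0,n)$ satisfies $n<\lambda_1$ (these points are inside $\lambda$). *)

(* Defs.v *)
From mathcomp Require Import all_boot.

Set Implicit Arguments.
Unset Strict Implicit.
Unset Printing Implicit Defensive.

(* The parts are 0-indexed: the part lambda_r is nth 0 la r.-1, and the default
   value 0 of nth is the convention lambda_r = 0 for r > k. *)
Definition is_partition (la : seq nat) : bool :=
  sorted geq la && all (fun x => 0 < x) la.

(* Vertices (i, j) in matrix-style coordinates: i = row, increasing to the
   south; j = column, increasing to the east. *)
Definition vertex : Type := (nat * nat)%type.

Definition north_step : rel vertex :=
  fun u v => (u.1 == v.1.+1) && (v.2 == u.2).

Definition east_step : rel vertex :=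
  fun u v => (v.1 == u.1) && (v.2 == u.2.+1).

(* As in path.v, the path u :: p is given by its start u and its tail p. *)
Definition ne_path (u v : vertex) (p : seq vertex) : bool :=
  path (fun x y => north_step x y || east_step x y) u p && (last u p == v).

Definition not_inside (la : seq nat) (v : vertex) : bool := nth 0 la v.1 <= v.2.

Definition admissible (la : seq nat) (m n : nat) (p : seq vertex) : bool :=
  ne_path (m, 0) (0, n) p && all (not_inside la) ((m, 0) :: p).

(* A northeastern path from (m, 0) to (0, n) has m + n steps and stays in
   [0, m] x [0, n]; tuples over this box serve only to have a finite type to
   count in, and num_pathsP below shows that no path is lost. *)
Definition box_vertex (m n : nat) (x : 'I_m.+1 * 'I_n.+1) : vertex :=
  (nat_of_ord x.1, nat_of_ord x.2).

Definition num_paths (la : seq nat) (m n : nat) : nat :=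
  #|[set t : (m + n).-tuple ('I_m.+1 * 'I_n.+1)
      | admissible la m n (map (@box_vertex m n) t)]|.

Lemma ne_path_box (u v : vertex) (p : seq vertex) : ne_path u v p ->
  [/\ v.1 <= u.1, u.2 <= v.2, size p = (u.1 - v.1) + (v.2 - u.2)
    & all (fun x : vertex => (x.1 <= u.1) && (x.2 <= v.2)) p].
Proof.
elim: p u => [|w p IHp] u; rewrite /ne_path /=.
  by move/eqP=> ->; rewrite !subnn.
case/andP=> /andP[uw wp] lp.
have [|h1 h2 h3 h4] := IHp w; first by rewrite /ne_path wp.
case/orP: uw => /andP[/eqP e1 /eqP e2].
- have h1' : v.1 <= u.1 by rewrite e1 leqW.
  split=> //; first by rewrite -e2.
    by rewrite h3 e1 e2 subSn // addSn.
  rewrite h2 e1 leqnSn /=; apply: sub_all h4 => x /andP[xw ->].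
  by rewrite leqW.
- split; first by rewrite -e1.
  + by rewrite ltnW // -e2.
  + by rewrite h3 e1 e2 -addnS -subSn -?e2 // e2 subSS.
  + by rewrite e1 leqnn h2 /=; rewrite -e1.
Qed.

Lemma num_pathsP (la : seq nat) (m n : nat) :
  exists s : seq (seq vertex),
    [/\ uniq s, s =i admissible la m n & num_paths la m n = size s].
Proof.
pose f (t : (m + n).-tuple ('I_m.+1 * 'I_n.+1)) := map (@box_vertex m n) t.
pose A := [set t | admissible la m n (f t)].
have inj_f : injective f.
  move=> t1 t2 /inj_map eq_t; apply/val_inj/eq_t.
  by move=> [a b] [c d] [] /val_inj -> /val_inj ->.
exists (map f (enum A)); split.
- by rewrite map_inj_uniq ?enum_uniq.
- move=> p; apply/mapP/idP => [[t]|adm_p].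
    by rewrite mem_enum inE => adm_t ->.
  have /andP[/ne_path_box[_ _ /= sz_p box_p] _] := adm_p.
  rewrite !subn0 in sz_p.
  pose g (x : vertex) : 'I_m.+1 * 'I_n.+1 := (inord x.1, inord x.2).
  have sz_g : size (map g p) == m + n by rewrite size_map sz_p.
  have fg : f (Tuple sz_g) = p.
    rewrite /f /= -map_comp -[RHS]map_id; apply/eq_in_map => -[a b] /(allP box_p).
    by case/andP=> /= ha hb; rewrite /box_vertex /= !inordK.
  by exists (Tuple sz_g); rewrite ?mem_enum ?inE fg.
- by rewrite size_map -cardE.
Qed.

(* Main.v *)
Require Import Defs.
From mathcomp Require Import all_boot.
From mathcomp Require Import zify.

Set Implicit Arguments.
Unset Strict Implicit.
Unset Printing Implicit Defensive.

(** The theorem compares one path from (p, 0) to (0, q + 2) and one from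
    (p + 2, 0) to (0, q) with two paths from (p + 1, 0) to (0, q + 1), where
    i = p + 1.  Unless one of the two factors on the left vanishes, all vertices
    outside the diagram near the end points are available, and these paths differ
    only in how they enter and leave a common core: the strip of diagonals from
    the one through (p, 0) to the one through (0, q).  Let G a b count the paths
    in this strip from (p + a, a) to (b, q + b).  Listing the first or last steps
    gives
      N(p, q + 2)     = G 0 0 + 2 G 0 1 + G 0 2,
      N(p + 2, q)     = G 0 0 + 2 G 1 0 + G 2 0,
      N(p + 1, q + 1) = G 0 0 + G 0 1 + G 1 0 + G 1 1,
    and after expanding both sides the theorem is a sum of inequalities between
    products of two values of G.

    Two kinds are needed.  The minor inequality G 0 1 G 1 0 <= G 0 0 G 1 1 holds
    because paths with crossed end points meet, and exchanging their tails
    uncrosses them.  The others, such as G 0 b G 2 b' <= G 1 b G 1 b' for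
    b' <= b + 1, come from this injection: let P run from start 0 to end b and Q
    from start 2 to end b', and measure the gap Q - P on each diagonal, in units
    of (1, 1).  The gap starts at 2, ends at most at 1 and changes by at most 1 at
    a time, so it equals 1 somewhere; up to the first such diagonal replace P by
    P + (1, 1) and Q by Q - (1, 1), and there exchange the tails.  Until then Q
    is at least two units beyond P, so the shifted paths stay weakly southeast of
    P and cannot enter the diagram.  Comparing paths diagonal by diagonal, rather
    than after equally many steps, is what makes this work for an arbitrary
    diagram.

    Both injections are carried out by induction on the length, in the form of
    inequalities preserved when one more diagonal is added: a count on the new
    diagonal is a sum of two adjacent counts on the old one, or zero inside the
    diagram ([pascal_step_ratio_le], [pascal_step_log_concave]).  Reversing and
    transposing the paths ([walks_transpose]) exchanges starts and ends, so that
    each inequality proved for three starts also holds for three ends. *)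

(** * Inequalities preserved by adding a diagonal *)

Definition pascal_step (A : pred nat) (f : nat -> nat) : nat -> nat :=
  fun b => if A b then f b + f b.+1 else 0.

Definition ratio_le (f g : nat -> nat) : Prop :=
  forall b d, f (b + d) * g b <= f b * g (b + d).

(** Where A holds, the new difference at b < b' is a sum of four old ones at
    positions that are still weakly in order, since each moves by at most 1.  Since
    A is up-closed, a nonzero left side forces both positions to be admitted. *)
Lemma pascal_step_ratio_le (A : pred nat) (f g : nat -> nat) :
  (forall b, A b -> A b.+1) -> ratio_le f g ->
  ratio_le (pascal_step A f) (pascal_step A g).
Proof.
move=> upA fg b d; rewrite /pascal_step.
have upAD : A b -> A (b + d).
  by move=> Ab; elim: d => [|d IHd]; rewrite ?addn0 ?addnS; auto.
case: (boolP (A b)) => [/upAD -> | _]; last by rewrite muln0.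
case: d {upAD} => [|d]; first by rewrite addn0.
have h1 := fg b d.+1; have h2 := fg b d.+2; have h3 := fg b.+1 d.
have h4 := fg b.+1 d.+1; rewrite !(addSn, addnS) in h1 h2 h3 h4 *.
lia.
Qed.

(** With D b b' = g b * g b' - f b * h b', the first clause says D b b' >= 0 when
    b' - b <= 1.  It is not preserved alone: at b' = b + 1 the new difference
    involves D b (b + 2), which may be negative.  The second clause, for
    b' = b + d + 1, bounds D b b' together with its mirror image D (b' - 1) (b + 1)
    under the reflection b' - b |-> 2 - (b' - b).  In terms of paths, a pair that
    ends with gap at least 2 need not have had gap 1; if it has not, only the
    translation applies, and the result has the ends of the mirror image. *)
Definition log_concave_triple (f g h : nat -> nat) : Prop :=
  (forall b b', b' <= b.+1 -> f b * h b' <= g b * g b') /\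
  (forall b d, f b * h (b + d).+1 + f (b + d) * h b.+1
             <= g b * g (b + d).+1 + g (b + d) * g b.+1).

(** The sum D + its mirror image obeys the same recurrence as D, so the second
    clause reproduces itself where A holds, and at gap 1 it supplies the missing
    part of the first.  Where A excludes b, the term D b b' vanishes and its mirror
    image has gap at most 1, where the first clause applies. *)
Lemma pascal_step_log_concave (A : pred nat) (f g h : nat -> nat) :
  (forall b, A b -> A b.+1) -> log_concave_triple f g h ->
  log_concave_triple (pascal_step A f) (pascal_step A g) (pascal_step A h).
Proof.
move=> upA [near far].
have near' b b' : b' <= b.+1 ->
    pascal_step A f b * pascal_step A h b' <= pascal_step A g b * pascal_step A g b'.
  move=> le_b'; rewrite /pascal_step.
  case: (A b); rewrite ?mul0n //; case: (A b'); rewrite ?muln0 //.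
  have h1 := near b b' le_b'; have h2 := near b.+1 b' (leqW le_b').
  have h3 := near b.+1 b'.+1 le_b'.
  have [eq_b' | ne_b'] := eqVneq b' b.+1.
    (* here D b (b + 2) is compensated by its mirror image D (b + 1) (b + 1) *)
    have := far b 1; rewrite {b' le_b'}eq_b' addn1 in h1 h2 h3 *; lia.
  have h4 := near b b'.+1 ltac:(lia); lia.
split=> // b [|d].
  (* at gap 1 a pair is its own mirror image *)
  by have := near' b b.+1 (leqnn _); rewrite addn0; lia.
have n1 := near' (b + d.+1) b.+1 ltac:(lia).
move: n1; rewrite /pascal_step; case: (boolP (A b)) => [Ab _ | _]; last by lia.
have upAD e : A (b + e).
  by elim: e => [|e IHe]; rewrite ?addn0 ?addnS; auto.
have -> : A (b + d.+1).+1 by rewrite -addnS.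
have -> : A b.+1 by rewrite -addn1.
rewrite upAD.
have h1 := far b d.+1; have h2 := far b d.+2; have h3 := far b.+1 d.
have h4 := far b.+1 d.+1; rewrite !(addSn, addnS) in h1 h2 h3 h4 *.
lia.
Qed.

(** * Counting paths through a set of admitted vertices *)

Fixpoint walks (V : rel nat) (n r c r' c' : nat) : nat :=
  if ~~ V r c then 0 else
  if n is n'.+1 then
    (if r is r1.+1 then walks V n' r1 c r' c' else 0) + walks V n' r c.+1 r' c'
  else (r == r') && (c == c').

Lemma walks0 (V : rel nat) r c r' c' :
  walks V 0 r c r' c' = if V r' c' then (r == r') && (c == c') else false.
Proof.
rewrite /=; case: eqP => [->|_]; last by rewrite !if_same.
by case: eqP => [->|_]; rewrite ?if_same //; case: (V r' c').
Qed.

Lemma walks_invalid_start (V : rel nat) n r c r' c' :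
  ~~ V r c -> walks V n r c r' c' = 0.
Proof. by case: n => [|n] /= ->. Qed.

Lemma walksS (V : rel nat) n r c r' c' : V r c ->
  walks V n.+1 r c r' c'
  = (if r is r1.+1 then walks V n r1 c r' c' else 0) + walks V n r c.+1 r' c'.
Proof. by move=> /= ->. Qed.

Lemma walks_last_step (V : rel nat) n r c r' c' :
  walks V n.+1 r c r' c' =
  if V r' c' then
    walks V n r c r'.+1 c' + (if c' is c1.+1 then walks V n r c r' c1 else 0)
  else 0.
Proof.
elim: n r c => [|n IHn] r c; have [Vrc|nVrc] := boolP (V r c).
- have start x y : walks V 0 r c x y = (r == x) && (c == y) by rewrite /= Vrc.
  rewrite walksS // !start.
  case: r {Vrc} start => [|r] start; case: c' => [|c'];
    rewrite ?start ?walks0 ?eqSS; case: (V r' _) => //=; lia.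
- rewrite /= nVrc /=; case: ifP; case: c' => //.
- rewrite walksS //.
  case: r Vrc => [|r] Vrc; rewrite !IHn [walks V n.+1 _ _ r'.+1 _]walksS //;
    clear IHn; case: c' => [|c']; rewrite ?walksS //; case: ifP => // _; lia.
- by clear IHn; rewrite !walks_invalid_start //; case: c' => [|c'];
    rewrite ?walks_invalid_start // if_same.
Qed.

Lemma walks_transpose (V : rel nat) n r c r' c' :
  walks V n r c r' c' = walks (fun x y => V y x) n c' r' c r.
Proof.
elim: n r' c' => [|n IHn] r' c'.
  rewrite walks0 /= [c' == c]eq_sym [r' == r]eq_sym andbC.
  by case: (V r' c').
rewrite walks_last_step /=; case: (V r' c') => //=.
by rewrite addnC IHn; case: c' => [|c']; rewrite ?IHn.
Qed.

(** * Paths between two diagonals *)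

(** Paths of length n to (b, q + b), indexed by the column c of their start, whose
    row is then n + c - q.  Columns make the recurrence in n a [pascal_step]: a
    north step keeps c and an east step raises it.  The test makes the value 0
    where the row would be negative. *)
Definition walks_on_diagonal (V : rel nat) (q b n c : nat) : nat :=
  if q <= n + c then walks V n (n + c - q) c b (q + b) else 0.

Lemma walks_on_diagonalS (V : rel nat) q b n c :
  walks_on_diagonal V q b n.+1 c =
  pascal_step (fun x => (q <= n.+1 + x) && V (n.+1 + x - q) x)
    (walks_on_diagonal V q b n) c.
Proof.
rewrite /pascal_step /walks_on_diagonal.
case: leqP => // le_q; rewrite andTb.
have [Vc|nVc] := boolP (V _ _); last by rewrite walks_invalid_start.
rewrite walksS // addnS -addSn le_q; congr (_ + _).
case: (leqP q (n + c)) => [le_q'|lt_q]; first by rewrite addSn subSn.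
by have -> : n.+1 + c - q = 0 by lia.
Qed.

Definition diagonal_closed (V : rel nat) : Prop :=
  forall r c, V r c -> V r.+1 c.+1.

Lemma diagonal_closed_step (V : rel nat) q n b : diagonal_closed V ->
  (q <= n + b) && V (n + b - q) b -> (q <= n + b.+1) && V (n + b.+1 - q) b.+1.
Proof.
move=> dV /andP[le_q Vb]; rewrite addnS leqW //= subSn //; exact: dV.
Qed.

Lemma walks_on_diagonal0 (V : rel nat) q b c :
  walks_on_diagonal V q b 0 c = V b (q + b) && (c == q + b).
Proof.
rewrite /walks_on_diagonal walks0 add0n; case: leqP => le_q; last by lia.
by case: (V _ _) => //=; lia.
Qed.

Lemma walks_on_diagonal_ratio_le (V : rel nat) q n : diagonal_closed V ->
  ratio_le (walks_on_diagonal V q 0 n) (walks_on_diagonal V q 1 n).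
Proof.
move=> dV; elim: n => [|n IHn] b d.
  by rewrite !walks_on_diagonal0; do 2!case: (V _ _); lia.
rewrite !walks_on_diagonalS; apply: pascal_step_ratio_le => // x.
exact: diagonal_closed_step.
Qed.

Lemma walks_on_diagonal_log_concave (V : rel nat) q n : diagonal_closed V ->
  log_concave_triple (walks_on_diagonal V q 0 n) (walks_on_diagonal V q 1 n)
    (walks_on_diagonal V q 2 n).
Proof.
move=> dV; elim: n => [|n IHn].
  have := @dV 0 (q + 0); rewrite -addnS => V01.
  split=> b b'; rewrite !walks_on_diagonal0.
    by move=> ?; do 3!case: (V _ _); lia.
  case: (V 0 _) V01 => [-> //|_]; last by rewrite !mul0n.
  case: (V 2 _) => /=; last by rewrite !muln0.
  nia.
have [near far] :=
  pascal_step_log_concave (fun x => @diagonal_closed_step V q n.+1 x dV) IHn.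
by split=> b b'; rewrite !walks_on_diagonalS; [exact: near | exact: far].
Qed.

(** * Log concavity at three consecutive starts *)

Lemma walks_log_concave (V : rel nat) p q :
  (forall r c, V r c -> V r.+1 c) -> (forall r c, V r c -> V r c.+1) ->
  walks V (p + q.+2) p 0 0 q.+2 * walks V (p.+2 + q) p.+2 0 0 q
  <= walks V (p.+1 + q.+1) p.+1 0 0 q.+1 ^ 2.
Proof.
move=> Vs Ve.
have dV : diagonal_closed V by move=> r c /Vs/Ve.
have dV' : diagonal_closed (fun x y => V y x) by move=> r c /Vs/Ve.
rewrite !(addnS, addSn).
have [Vp|nVp] := boolP (V p 0); last by rewrite walks_invalid_start.
have [Vq|nVq] := boolP (V 0 q); last first.
  by rewrite [walks V _ p.+2 _ _ _]walks_last_step (negPf nVq) muln0.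
pose G a b := walks V (p + q) (p + a) a b (q + b).
have GE a b : walks_on_diagonal V q b (p + q) a = G a b.
  rewrite /walks_on_diagonal /G; case: leqP; last by lia.
  by have -> : p + q + a - q = p + a by lia.
have GE' a b : walks_on_diagonal (fun x y => V y x) p a (p + q) b = G a b.
  rewrite /walks_on_diagonal /G walks_transpose.
  case: leqP; last by lia.
  by have -> : p + q + b - p = q + b by lia.
have V01 := Ve _ _ Vq; have V02 := Ve _ _ V01; have V12 := Vs _ _ V02.
have V10 := Vs _ _ Vp; have V20 := Vs _ _ V10; have V21 := Ve _ _ V20.
have e1 : walks V (p + q).+2 p 0 0 q.+2 = G 0 0 + 2 * G 0 1 + G 0 2.
  rewrite !walks_last_step V02 V12 V01 /G !(addn0, addn1, addn2); lia.
have e2 : walks V (p + q).+2 p.+2 0 0 q = G 0 0 + 2 * G 1 0 + G 2 0.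
  rewrite !walksS // /G !(addn0, addn1, addn2); lia.
have e3 : walks V (p + q).+2 p.+1 0 0 q.+1 = G 0 0 + G 0 1 + G 1 0 + G 1 1.
  rewrite walksS // !walks_last_step V01 /G !(addn0, addn1, addn2); lia.
(* the columns of starts 0, 1, 2 on the first diagonal are again 0, 1, 2, and so
   are the rows of the ends: hence the arguments below *)
have [ends _] := walks_on_diagonal_log_concave q (p + q) dV.
have [starts _] := walks_on_diagonal_log_concave p (p + q) dV'.
have minor := @walks_on_diagonal_ratio_le _ q (p + q) dV 0 1.
have s00 := starts 0 0 isT; have s10 := starts 1 0 isT; have s20 := starts 2 0 isT.
have t00 := ends 0 0 isT; have t10 := ends 1 0 isT; have t11 := ends 1 1 isT.
rewrite add0n !GE in minor s00 s10 s20 t00 t10 t11.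
rewrite !GE' in s00 s10 s20.
rewrite mulnC in t11; have g02g20 := leq_trans s20 t11.
(* 4 G01 G10 is bounded half by the minor inequality and half by the term
   2 G01 G10 of the square; g02g20 bounds G02 G20 by moving first the starts to
   1, 1 and then the ends *)
rewrite e1 e2 e3 -mulnn; lia.
Qed.

(** * The count as a recursion *)

Lemma mem_map_cons (T : eqType) (x y : T) (p : seq T) (s : seq (seq T)) :
  (y :: p \in map (cons x) s) = (y == x) && (p \in s).
Proof.
by apply/mapP/andP => [[p1 ps [-> ->]] | [/eqP -> ps]]; [rewrite eqxx | exists p].
Qed.

(** The walks are listed by their first step, and since duplicate-free lists with
    the same members have the same size, any such list computes [num_paths]. *)
Lemma count_admissible_walks (la : seq nat) n (u v : vertex) :
  exists s : seq (seq vertex),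
    [/\ uniq s,
        s =i [pred p | [&& size p == n, ne_path u v p & all (not_inside la) (u :: p)]]
      & size s = walks (fun r c => not_inside la (r, c)) n u.1 u.2 v.1 v.2].
Proof.
elim: n u => [|n IHn] [r c].
  exists (if not_inside la (r, c) && ((r, c) == v) then [:: [::]] else [::]).
  split; first by case: ifP.
    move=> p; rewrite !inE /ne_path; case: p => [|x p]; rewrite ?eqxx /=.
      by rewrite andbT andbC; case: ifP.
    by case: ifP.
  case: v => r' c' /=; case: (not_inside la (r, c)) => //=.
  by rewrite xpair_eqE; case: ifP.
have [Vrc|nVrc] := boolP (not_inside la (r, c)); last first.
  exists [::]; split=> //=; last by rewrite nVrc.
  by move=> p; rewrite !inE /= (negPf nVrc) !andbF.
have [sE [uE memE szE]] := IHn (r, c.+1).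
have [sN [uN memN szN]] : exists s : seq (seq vertex),
    [/\ uniq s, s =i [pred p | [&& r > 0, size p == n, ne_path (r.-1, c) v p &
          all (not_inside la) ((r.-1, c) :: p)]]
      & size s = if r is r1.+1 then
          walks (fun r c => not_inside la (r, c)) n r1 c v.1 v.2 else 0].
  by clear -IHn; case: r => [|r1]; [exists [::]; split | exact: (IHn (r1, c))].
exists (map (cons (r.-1, c)) sN ++ map (cons (r, c.+1)) sE); split.
- rewrite cat_uniq !map_inj_uniq ?uN ?uE; try by move=> ? ? [].
  rewrite andbT /=; apply/hasPn => _ /mapP[p _ ->].
  by apply/mapP => -[p' _ [_ /n_Sn]] || by apply/mapP => -[p' _ []]; lia.
- move=> p; rewrite mem_cat !inE; case: p => [|[x y] p].
    by rewrite /=; apply/orP => -[] /mapP[].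
  rewrite !mem_map_cons memN memE !inE /ne_path /= Vrc eqSS !xpair_eqE
    /north_step /east_step /=.
  case: r {Vrc uN memN szN memE szE} => [|r] /=.
  - rewrite andbF /=; case: (x =P 0) => [->|_]; last by rewrite !andbF.
    by case: (y =P c.+1) => [->|_]; rewrite ?andbF.
  - have neqS k : (k == k.+1) = false by lia.
    rewrite eqSS [r == x]eq_sym.
    case: (x =P r) => [->|_]; last case: (x =P r.+1) => [->|_].
    + rewrite neqS orbF; case: (y =P c) => [->|_]; by rewrite ?orbF ?andbF.
    + by case: (y =P c.+1) => [->|_]; rewrite /= ?andbF.
    + by rewrite /= ?andbF.
- by rewrite size_cat !size_map szN szE /= Vrc.
Qed.

Lemma num_paths_walks (la : seq nat) m n :
  num_paths la m n = walks (fun r c => not_inside la (r, c)) (m + n) m 0 0 n.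
Proof.
have [s [us ms ->]] := num_pathsP la m n.
have [t [ut mt /= <-]] := count_admissible_walks la (m + n) (m, 0) (0, n).
apply/perm_size/uniq_perm => // p; rewrite ms mt !inE /=.
rewrite [p \in _]/(admissible la m n p) /admissible.
case np: (ne_path _ _ p); last by rewrite andbF.
by have [_ _ -> _] := ne_path_box np; rewrite /= !subn0 eqxx.
Qed.

Theorem theorem1 (la : seq nat) (hla : is_partition la) (m n : nat) :
  let L := m + n in
  let a := fun i : nat => num_paths la i (L - i) in
  forall i : nat, 1 <= i <= L - 1 -> a i.-1 * a i.+1 <= a i ^ 2.
Proof.
move=> L a [//|p] /andP[_ le_p].
(* the bound on i leaves room for q >= 0 with L - i = q + 1 *)
have [q eL] : exists q, L = p + q.+2 by exists (L - p.+2); lia.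
rewrite /a eL /= addKn.
have -> : p + q.+2 - p.+2 = q by lia.
have -> : p + q.+2 - p.+1 = q.+1 by lia.
rewrite !num_paths_walks.
have /andP[la_sorted _] := hla.
apply: walks_log_concave => r c; rewrite /not_inside /=; last exact: leqW.
apply: leq_trans.
have [lt_r|le_r] := ltnP r.+1 (size la); last by rewrite nth_default.
exact: (sortedP 0 la_sorted).
Qed.
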